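(* Let $(X,D,P)$ be a complete perturbed metric space with exact metric $d=D-P$. Let $T:X\to X$ and let $a,b,c,h,e\ge 0$ be such that for all $x,y\in X$ $$D(Tx,Ty)\le a\,D(x,y)+b\,D(x,Tx)+c\,D(y,Ty)+h\,D(x,Ty)+e\,D(y,Tx).$$ Let $a_0,b_0,c_0,h_0,e_0\ge 0$ be constants such that for all $x,y\in X$ $$a\,P(x,y)+b\,P(x,Tx)+c\,P(y,Ty)+h\,P(x,Ty)+e\,P(y,Tx)\le a_0\,d(x,y)+b_0\,d(x,Tx)+c_0\,d(y,Ty)+h_0\,d(x,Ty)+e_0\,d(y,Tx),$$ and suppose $(a+a_0)+(b+b_0)+(c+c_0)+(h+h_0)+(e+e_0)<1$. Put $A=a+a_0$, $B=b+b_0$, $C=c+c_0$, $H=h+h_0$, $E=e+e_0$ and $$\kappa:=\frac{2A+B+C+H+E}{2-(B+C+H+E)}.$$ Then $\kappa\in[0,1)$, $T$ has a unique fixed point $x^\ast\in X$, and for every $x_0\in X$ the Picard sequence $x_{n+1}=Tx_n$ ($n\ge 0$) converges to $x^\ast$ in $(X,d)$ and satisfies $d(x_n,x_{n+1})\le\kappa^{\,n}\,d(x_0,x_1)$ for all $n\ge 0$.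
   Context: A perturbed metric space $(X,D,P)$ consists of a nonempty set $X$ and two functions $D,P:X\times X\to[0,\infty)$ such that $d(x,y):=D(x,y)-P(x,y)$ is a metric on $X$, called the exact metric. Neither $D$ nor $P$ is assumed symmetric, and $P$ need not vanish on the diagonal. $(X,D,P)$ is called complete if the metric space $(X,d)$ is complete. *)

(* Defs.v *)
From HB Require Import structures.
From mathcomp Require Import all_boot all_order all_algebra.
From mathcomp Require Import all_classical all_reals all_analysis.

Set Implicit Arguments.
Unset Strict Implicit.
Unset Printing Implicit Defensive.

Import Order.TTheory GRing.Theory Num.Theory.

Local Open Scope ring_scope.

(* A perturbed metric space (X, D, P), with D := perturbed_dist and
   P := perturbation. The library metric mdist of X, and hence its topology
   and its notion of completeness, are those of the exact metric d = D - P. *)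
HB.mixin Record Metric_isPerturbedMetric (R : numFieldType) X & Metric R X := {
  perturbed_dist : X -> X -> R ;
  perturbation : X -> X -> R ;
  perturbed_dist_ge0 : forall x y, 0 <= perturbed_dist x y ;
  perturbation_ge0 : forall x y, 0 <= perturbation x y ;
  mdistEperturbed : forall x y,
    mdist x y = perturbed_dist x y - perturbation x y
}.

#[short(type="perturbedMetricType")]
HB.structure Definition PerturbedMetric (R : numFieldType) :=
  {X of Metric R X & Metric_isPerturbedMetric R X}.

(* Complete is a structure on pointed types, so X is nonempty here. *)
#[short(type="completePerturbedMetricType")]
HB.structure Definition CompletePerturbedMetric (R : numFieldType) :=
  {X of PerturbedMetric R X & Complete X}.

(* Any nonnegative D and P such that D - P satisfies the axioms of a metric
   give rise to the structure above. *)
HB.factory Record isPerturbedMetric (R : numFieldType) (X : Type)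
    & Choice X := {
  perturbed_dist : X -> X -> R ;
  perturbation : X -> X -> R ;
  perturbed_dist_ge0 : forall x y, 0 <= perturbed_dist x y ;
  perturbation_ge0 : forall x y, 0 <= perturbation x y ;
  exact_distxx : forall x, perturbed_dist x x - perturbation x x = 0 ;
  exact_dist_positivity : forall x y,
    perturbed_dist x y - perturbation x y = 0 -> x = y ;
  exact_dist_sym : forall x y,
    perturbed_dist x y - perturbation x y =
    perturbed_dist y x - perturbation y x ;
  exact_dist_triangle : forall y x z,
    perturbed_dist x z - perturbation x z <=
    (perturbed_dist x y - perturbation x y) +
    (perturbed_dist y z - perturbation y z)
}.

HB.builders Context R X & isPerturbedMetric R X.

HB.instance Definition _ := @isMetric.Build R X
  (fun x y => perturbed_dist x y - perturbation x y)
  exact_distxx exact_dist_positivity exact_dist_sym exact_dist_triangle.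

HB.instance Definition _ := @Metric_isPerturbedMetric.Build R X
  perturbed_dist perturbation perturbed_dist_ge0 perturbation_ge0
  (fun _ _ => erefl).

HB.end.

(* Main.v *)
Require Import Defs.
From HB Require Import structures.
From mathcomp Require Import all_boot all_order all_algebra.
From mathcomp Require Import all_classical all_reals all_analysis.
From mathcomp Require Import ring lra.

(**
Since P >= 0, we have d <= D, so adding the two hypotheses turns the
perturbed contraction into the Hardy-Rogers inequality
  d(Tx,Ty) <= A d(x,y) + B d(x,Tx) + C d(y,Ty) + H d(x,Ty) + E d(y,Tx)
for the exact metric. Applying it to (x, Tx) and to (Tx, x) and averaging
makes the roles of B, C and of H, E symmetric and gives
d(Tx,TTx) <= kappa d(x,Tx). Hence Picard sequences are Cauchy, and
the Hardy-Rogers inequality at (x_n, z) shows that their limit z is fixed.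
*)

Set Implicit Arguments.
Unset Strict Implicit.
Unset Printing Implicit Defensive.

Import Order.TTheory GRing.Theory Num.Theory.

Local Open Scope classical_set_scope.
Local Open Scope ring_scope.

Lemma mdist_geometric_le (R : realFieldType) (X : metricType R)
    (u : nat -> X) (k M : R) :
  0 <= k -> k < 1 -> 0 <= M ->
  (forall n, mdist (u n) (u n.+1) <= k ^+ n * M) ->
  forall m n, mdist (u n) (u (n + m)%N) <= M / (1 - k) * k ^+ n.
Proof.
move=> k0 k1 M0 uk m n.
have nz : 1 - k != 0 by rewrite subr_eq0 gt_eqF.
(* The induction on [m] needs the exact partial geometric sum: each new step [k ^+ (n + m) * M]
   equals [M / (1 - k) * (k ^+ (n + m) - k ^+ (n + m).+1)], so the bounds telescope. *)
suff: mdist (u n) (u (n + m)%N) <= M / (1 - k) * (k ^+ n - k ^+ (n + m)).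
  move/le_trans; apply; rewrite ler_wpM2l ?divr_ge0 ?subr_ge0 ?(ltW k1)//.
  by rewrite gerBl exprn_ge0.
elim: m => [|m IH]; first by rewrite addn0 mdistxx subrr mulr0.
rewrite addnS (le_trans (metric_triangle _ (u (n + m)%N) _))//.
apply: le_trans (lerD IH (uk _)) _.
rewrite -[X in _ + X * M](subrK (k ^+ (n + m).+1)) le_eqVlt; apply/orP; left.
apply/eqP; rewrite exprS; set p := k ^+ n; set q := k ^+ (n + m).
have -> : M = M / (1 - k) * (1 - k) by rewrite divfK.
rewrite mulfK//; ring.
Qed.

Lemma cauchy_geometric_mdist (R : realType) (X : metricType R)
    (u : nat -> X) (k M : R) :
  0 <= k -> k < 1 ->
  (forall n, mdist (u n) (u n.+1) <= k ^+ n * M) ->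
  cauchy (u n @[n --> \oo]).
Proof.
move=> k0 k1 uk.
have M0 : 0 <= M by have := le_trans (mdist_ge0 _ _) (uk 0%N); rewrite mul1r.
apply: cauchy_exP => eps eps0.
have /cvgrPdist_lt/(_ _ eps0)[N _ NP] : M / (1 - k) * k ^+ n @[n --> \oo] --> 0.
  by apply: cvg_geometric; rewrite ger0_norm.
(* It suffices that some ball of radius [eps] contains a tail. The centre [u N] works once the
   geometric bound at [N] is below [eps]. *)
exists (u N); exists N => // n /= Nn; rewrite ballEmdist/= -(subnKC Nn).
apply: le_lt_trans (mdist_geometric_le k0 k1 M0 uk _ _) _.
have := NP N (leqnn _); rewrite sub0r normrN ger0_norm//.
by rewrite mulr_ge0 ?exprn_ge0// divr_ge0// subr_ge0 ltW.
Qed.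

Definition hardy_rogers (R : realFieldType) (X : metricType R) (T : X -> X)
    (A B C H E : R) := forall x y : X,
  mdist (T x) (T y) <= A * mdist x y + B * mdist x (T x) + C * mdist y (T y)
                       + H * mdist x (T y) + E * mdist y (T x).

Definition hardy_rogers_coef (R : realFieldType) (A B C H E : R) :=
  [/\ 0 <= A, 0 <= B, 0 <= C, 0 <= H & 0 <= E] /\ A + B + C + H + E < 1.

Definition hardy_rogers_rate (R : realFieldType) (A B C H E : R) :=
  (2 * A + B + C + H + E) / (2 - (B + C + H + E)).

Lemma hardy_rogers_rate_ge0 (R : realFieldType) (A B C H E : R) :
  hardy_rogers_coef A B C H E -> 0 <= hardy_rogers_rate A B C H E.
Proof. by move=> [[A0 B0 C0 H0 E0] lt1]; rewrite divr_ge0//; lra. Qed.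

(** The denominator exceeds 1, and it exceeds the numerator exactly when twice the sum of the
    coefficients is below 2. *)
Lemma hardy_rogers_rate_lt1 (R : realFieldType) (A B C H E : R) :
  hardy_rogers_coef A B C H E -> hardy_rogers_rate A B C H E < 1.
Proof. by move=> [[A0 B0 C0 H0 E0] lt1]; rewrite ltr_pdivrMr; lra. Qed.

Section HardyRogers.
Context (R : realFieldType) (X : metricType R) (T : X -> X) (A B C H E : R).
Hypothesis coef : hardy_rogers_coef A B C H E.
Hypothesis T_HR : hardy_rogers T A B C H E.

Let kappa := hardy_rogers_rate A B C H E.

Lemma hardy_rogers_step x :
  mdist (T x) (T (T x)) <= kappa * mdist x (T x).
Proof.
case: coef => -[A0 B0 C0 H0 E0] lt1.
rewrite /kappa /hardy_rogers_rate mulrAC ler_pdivlMr; last lra.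
have := T_HR x (T x); have := T_HR (T x) x; rewrite !mdistxx.
rewrite (metric_sym (T (T x)) (T x)) (metric_sym (T x) x).
(* With [p], [q], [r] as named below, the two instances read [q <= (A + B) * p + C * q + H * r] and
   [q <= (A + C) * p + B * q + E * r]. Adding them and using [r <= p + q] gives the rate. *)
have := metric_triangle x (T x) (T (T x)).
move: (mdist x (T x)) (mdist (T x) _) (mdist x _) => p q r tri.
have := ler_wpM2l H0 tri; have := ler_wpM2l E0 tri; lra.
Qed.

Lemma hardy_rogers_iter x n :
  mdist (iter n T x) (iter n.+1 T x) <= kappa ^+ n * mdist x (T x).
Proof.
elim: n => [|n IH]; first by rewrite mul1r.
apply: le_trans (hardy_rogers_step _) _.
by rewrite exprS -mulrA ler_wpM2l// hardy_rogers_rate_ge0.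
Qed.

Lemma hardy_rogers_fixed_uniq x y : T x = x -> T y = y -> x = y.
Proof.
case: coef => -[A0 B0 C0 H0 E0] lt1.
move=> Tx Ty; apply: mdist_positivity; apply/eqP.
rewrite eq_le mdist_ge0 andbT leNgt; apply/negP => d0.
have := T_HR x y; rewrite Tx Ty !mdistxx (metric_sym y x).
(* The instance reduces to [d <= (A + H + E) * d] with [d > 0] and [A + H + E < 1]. *)
nra.
Qed.

(** [T] may be discontinuous, so the limit cannot be passed through it. Instead, if
    [delta = mdist y (T y)] were positive, comparing [y] with a late iterate [z] would bound
    [(1 - C - H) * delta] by arbitrarily small terms. *)
Lemma hardy_rogers_lim_fixed x y :
  iter n T x @[n --> \oo] --> y -> T y = y.
Proof.
case: coef => -[A0 B0 C0 H0 E0] lt1.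
move=> /metricType_numDomainType.cvgr_dist_lt xy.
apply/esym/mdist_positivity/eqP; rewrite eq_le mdist_ge0 andbT leNgt.
apply/negP => d0; set delta := mdist y (T y) in d0.
(* The final estimate is [(1 - C - H) * delta <= 3 * p + 3 * q < 6 * eps], every coefficient being
   at most 1, so the divisor 8 leaves room. *)
pose eps := (1 - C - H) * delta / 8.
have eps0 : 0 < eps by rewrite /eps divr_gt0// mulr_gt0//; lra.
have [N _ Nxy] := xy _ eps0.
set z := iter N T x.
have yz : mdist y z < eps by exact: Nxy (leqnn N).
(* [T z] is the iterate of index [N.+1], still in the tail. *)
have yTz : mdist y (T z) < eps by exact: Nxy (leqnSn N).
have := T_HR z y; have := metric_triangle y (T z) (T y).
have := metric_triangle z y (T y); have := metric_triangle z y (T z).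
rewrite (metric_sym z y) -/delta.
have p0 : 0 <= mdist y z := mdist_ge0 _ _.
have q0 : 0 <= mdist y (T z) := mdist_ge0 _ _.
have : eps * 8 = (1 - C - H) * delta by rewrite /eps divfK.
move: (mdist y z) (mdist y (T z)) (mdist z (T z)) (mdist z (T y))
  (mdist (T z) (T y)) p0 q0 yz yTz => p q r s t p0 q0 yz yTz epsE rle sle dle tle.
have := ler_wpM2l B0 rle; have := ler_wpM2l H0 sle.
have Ap : A * p <= p by rewrite ler_piMl//; lra.
have Bp : B * p <= p by rewrite ler_piMl//; lra.
have Bq : B * q <= q by rewrite ler_piMl//; lra.
have Hp : H * p <= p by rewrite ler_piMl//; lra.
have Eq : E * q <= q by rewrite ler_piMl//; lra.
lra.
Qed.

End HardyRogers.

Lemma perturbed_hardy_rogers (R : realType) (X : perturbedMetricType R)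
    (T : X -> X) (a b c h e a0 b0 c0 h0 e0 : R)
    (D := @perturbed_dist R X) (P := @perturbation R X) (d := @mdist R X) :
  (forall x y : X,
    D (T x) (T y) <= a * D x y + b * D x (T x) + c * D y (T y)
                     + h * D x (T y) + e * D y (T x)) ->
  (forall x y : X,
    a * P x y + b * P x (T x) + c * P y (T y) + h * P x (T y) + e * P y (T x)
    <= a0 * d x y + b0 * d x (T x) + c0 * d y (T y)
       + h0 * d x (T y) + e0 * d y (T x)) ->
  hardy_rogers T (a + a0) (b + b0) (c + c0) (h + h0) (e + e0).
Proof.
move=> TD TP x y.
have DE u v : D u v = d u v + P u v by rewrite /d mdistEperturbed subrK.
have := TD x y; have := TP x y; have : 0 <= P (T x) (T y) := perturbation_ge0 _ _.
rewrite !DE -/d; lra.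
Qed.

Theorem theorem3p1 (R : realType) (X : completePerturbedMetricType R)
    (T : X -> X) (a b c h e a0 b0 c0 h0 e0 : R)
    (D := @perturbed_dist R X) (P := @perturbation R X) (d := @mdist R X)
    (A := a + a0) (B := b + b0) (C := c + c0) (H := h + h0) (E := e + e0)
    (kappa := (2 * A + B + C + H + E) / (2 - (B + C + H + E))) :
  0 <= a -> 0 <= b -> 0 <= c -> 0 <= h -> 0 <= e ->
  (forall x y : X,
    D (T x) (T y) <= a * D x y + b * D x (T x) + c * D y (T y)
                     + h * D x (T y) + e * D y (T x)) ->
  0 <= a0 -> 0 <= b0 -> 0 <= c0 -> 0 <= h0 -> 0 <= e0 ->
  (forall x y : X,
    a * P x y + b * P x (T x) + c * P y (T y) + h * P x (T y) + e * P y (T x)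
    <= a0 * d x y + b0 * d x (T x) + c0 * d y (T y)
       + h0 * d x (T y) + e0 * d y (T x)) ->
  A + B + C + H + E < 1 ->
  [/\ 0 <= kappa, kappa < 1
    & exists xstar : X,
      unique (fun x : X => T x = x) xstar /\
      forall x0 : X,
        iter n T x0 @[n --> \oo] --> xstar /\
        forall n : nat,
          d (iter n T x0) (iter n.+1 T x0) <= kappa ^+ n * d x0 (T x0)].
Proof.
move=> a_ge0 b_ge0 c_ge0 h_ge0 e_ge0 TD a0_ge0 b0_ge0 c0_ge0 h0_ge0 e0_ge0 TP lt1.
have coef : hardy_rogers_coef A B C H E by split=> //; split; exact: addr_ge0.
have T_HR : hardy_rogers T A B C H E by exact: perturbed_hardy_rogers.
have k0 : 0 <= kappa by exact: hardy_rogers_rate_ge0 coef.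
have k1 : kappa < 1 by exact: hardy_rogers_rate_lt1 coef.
have Titer x n : d (iter n T x) (iter n.+1 T x) <= kappa ^+ n * d x (T x).
  exact: hardy_rogers_iter coef T_HR x n.
have Tcvg x : cvg (iter n T x @[n --> \oo]).
  by apply: cauchy_cvg; exact: cauchy_geometric_mdist k0 k1 (Titer x).
have Tuniq : forall x y, T x = x -> T y = y -> x = y.
  by move=> x y; exact: hardy_rogers_fixed_uniq coef T_HR x y.
have Tlim x : T (lim (iter n T x @[n --> \oo])) = lim (iter n T x @[n --> \oo]).
  by apply: (hardy_rogers_lim_fixed coef T_HR (x := x)); exact: Tcvg.
(* The witness is the limit of the orbit of an arbitrary base point. Every other orbit also
   converges to a fixed point, which uniqueness identifies with this one. *)
split=> //; exists (lim (iter n T point @[n --> \oo])).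
split; first by split=> // y Ty; exact: Tuniq.
move=> x; split=> //.
by rewrite (Tuniq _ _ (Tlim point) (Tlim x)); exact: Tcvg.
Qed.
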